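(* Each amenable group $X$ is twinic, and the twinic ideal $\mathbb I$ of $X$ lies in the ideal $\mathcal N$ of absolutely null subsets of $X$.
   Context: An ideal on a group $X$ is a nonempty family $\mathcal I$ of subsets of $X$ closed under finite unions and subsets, with $X\notin\mathcal I$; it is left-invariant if $xA\in\mathcal I$ for all $A\in\mathcal I$, $x\in X$. $A\subset_{\mathcal I}B$ means $A\setminus B\in\mathcal I$; $A=_{\mathcal I}B$ means $A\subset_{\mathcal I}B$ and $B\subset_{\mathcal I}A$. A left-invariant ideal $\mathcal I$ on $X$ is twinic if for every $A\subset X$ and $x,y\in X$ with $xA\subset_{\mathcal I}X\setminus A\subset_{\mathcal I}yA$ one has $xA=_{\mathcal I}yA$. A group is twinic if it admits a twinic ideal; the twinic ideal $\mathbb I$ of a twinic group is the intersection of all its twinic ideals. A group $X$ is amenable if it admits a Banach measure, i.e. a left-invariant finitely additive probability measure $\mu:\mathsf P(X)\to[0,1]$ defined on all subsets of $X$. A subset $A\subset X$ of an amenable group is absolutely null if $\mu(A)=0$ for every Banach measure $\mu$ on $X$; $\mathcal N$ is the family of all absolutely null subsets. *)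

(* Defs.v *)
From HB Require Import structures.
From mathcomp Require Import all_boot all_order all_algebra.
From mathcomp Require Import all_classical all_reals.

Set Implicit Arguments.
Unset Strict Implicit.
Unset Printing Implicit Defensive.

Import Order.TTheory GRing.Theory Num.Theory.

Local Open Scope classical_set_scope.
Local Open Scope ring_scope.

Definition ltranslate (X : groupType) (x : X) (A : set X) : set X :=
  [set (x * a)%g | a in A].

Record is_ideal (X : groupType) (I : set (set X)) : Prop := IsIdeal {
  ideal_nonempty : I !=set0 ;
  ideal_setU : forall A B, I A -> I B -> I (A `|` B) ;
  ideal_subset : forall A B, A `<=` B -> I B -> I A ;
  ideal_proper : ~ I setT
}.

Definition left_invariant (X : groupType) (I : set (set X)) : Prop :=
  forall (A : set X) (x : X), I A -> I (ltranslate x A).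

Definition subset_mod (X : groupType) (I : set (set X)) (A B : set X) : Prop :=
  I (A `\` B).

Definition eq_mod (X : groupType) (I : set (set X)) (A B : set X) : Prop :=
  subset_mod I A B /\ subset_mod I B A.

Record is_twinic_ideal (X : groupType) (I : set (set X)) : Prop :=
  IsTwinicIdeal {
  twinic_is_ideal : is_ideal I ;
  twinic_left_invariant : left_invariant I ;
  twinic_eq_mod : forall (A : set X) (x y : X),
    subset_mod I (ltranslate x A) (~` A) ->
    subset_mod I (~` A) (ltranslate y A) ->
    eq_mod I (ltranslate x A) (ltranslate y A)
}.

Definition twinic (X : groupType) : Prop :=
  exists I : set (set X), is_twinic_ideal I.

(* If X is not twinic, this empty intersection is the whole powerset. *)
Definition twinic_ideal (X : groupType) : set (set X) :=
  \bigcap_(I in [set I : set (set X) | is_twinic_ideal I]) I.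

Record banach_measure (R : realType) (X : groupType) (mu : set X -> R) : Prop :=
  BanachMeasure {
  banach_itv : forall A, 0 <= mu A <= 1 ;
  banach_setT : mu setT = 1 ;
  banach_setU : forall A B, A `&` B = set0 -> mu (A `|` B) = mu A + mu B ;
  banach_ltranslate : forall (A : set X) (x : X), mu (ltranslate x A) = mu A
}.

Definition amenable (R : realType) (X : groupType) : Prop :=
  exists mu : set X -> R, banach_measure mu.

Definition absolutely_null (R : realType) (X : groupType) : set (set X) :=
  [set A | forall mu : set X -> R, banach_measure mu -> mu A = 0].

Arguments twinic_ideal : clear implicits.
Arguments absolutely_null : clear implicits.

(* Main.v *)
Require Import Defs.
From mathcomp Require Import all_boot all_order all_algebra.
From mathcomp Require Import all_classical all_reals.

Import Order.TTheory GRing.Theory Num.Theory.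

Local Open Scope classical_set_scope.

(** The family [N] of absolutely null sets is itself a twinic ideal, so it
    contains the intersection of all of them. Indeed, if [xA] is contained in
    [X \ A], and [X \ A] in [yA], modulo [N], then [xA \ yA] is in [N]; since
    [xA] and [yA] have the same measure, [yA \ xA] has the same measure as
    [xA \ yA], namely 0, for every Banach measure. *)

Lemma banach_ge0 {R : realType} {X : groupType} {mu : set X -> R} :
  banach_measure mu -> forall A, (0 <= mu A)%R.
Proof. by move=> hmu A; case/andP: (banach_itv hmu A). Qed.

Lemma banach_set0 {R : realType} {X : groupType} {mu : set X -> R} :
  banach_measure mu -> mu set0 = 0%R.
Proof.
(* [set0] is disjoint from itself, so additivity gives [mu set0 = mu set0 + mu set0]. *)
move=> hmu; have := banach_setU hmu (setI0 set0); rewrite setU0 => h.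
by apply: (addrI (mu set0)); rewrite addr0 -h.
Qed.

Lemma banach_setIDE {R : realType} {X : groupType} {mu : set X -> R} :
  banach_measure mu ->
  forall A B, mu A = (mu (A `&` B) + mu (A `\` B))%R.
Proof.
move=> hmu A B; rewrite -(banach_setU hmu) ?setUIDK //.
by rewrite -setIA setDIK setI0.
Qed.

Lemma le_banach {R : realType} {X : groupType} {mu : set X -> R} :
  banach_measure mu -> forall A B, A `<=` B -> (mu A <= mu B)%R.
Proof.
move=> hmu A B AB; rewrite (banach_setIDE hmu B A) (setIidr AB) lerDl.
exact: banach_ge0.
Qed.

(** A point of [A] outside [C] lies in [A \ B] or in [B \ C], according to whether it belongs to
    [B]. *)
Lemma subset_mod_trans {X : groupType} {I : set (set X)} :
  is_ideal I -> forall A B C,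
  subset_mod I A B -> subset_mod I B C -> subset_mod I A C.
Proof.
move=> idI A B C AB BC; apply: ideal_subset (ideal_setU idI AB BC) => //.
move=> z [Az nCz]; have [Bz|nBz] := pselect (B z); [right|left]; by split.
Qed.

Lemma absolutely_null_eq_mod (R : realType) (X : groupType) (A B : set X) :
  (forall mu : set X -> R, banach_measure mu -> mu A = mu B) ->
  subset_mod (absolutely_null R X) A B -> eq_mod (absolutely_null R X) A B.
Proof.
move=> eqAB AB; split=> // mu hmu; have := eqAB mu hmu.
rewrite (banach_setIDE hmu A B) (banach_setIDE hmu B A) (AB mu hmu).
by rewrite (setIC B A) => /addrI.
Qed.

(** Amenability serves properness: without a Banach measure every set, [setT] included, would be
    vacuously absolutely null. *)
Lemma absolutely_null_ideal (R : realType) (X : groupType) :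
  amenable R X -> is_ideal (absolutely_null R X).
Proof.
move=> [nu hnu]; split.
- by exists set0 => mu; apply: banach_set0.
(* The union is cut along [A]: one piece is [A] itself, the other lies inside [B]. *)
- move=> A B nA nB mu hmu; rewrite (banach_setIDE hmu _ A) setIidr; last exact: subsetUl.
  rewrite (nA mu hmu) add0r; apply/eqP; rewrite eq_le banach_ge0 // andbT.
  by rewrite -(nB mu hmu); apply: (le_banach hmu) => z [[]].
- move=> A B AB nB mu hmu; apply/eqP; rewrite eq_le banach_ge0 // andbT.
  by rewrite -(nB mu hmu); apply: le_banach.
- by move/(_ nu hnu)/eqP; rewrite (banach_setT hnu) oner_eq0.
Qed.

Lemma absolutely_null_twinic (R : realType) (X : groupType) :
  amenable R X -> is_twinic_ideal (absolutely_null R X).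
Proof.
move=> /absolutely_null_ideal idN; split=> //.
  by move=> A x nA mu hmu; rewrite (banach_ltranslate hmu); apply: nA.
move=> A x y xA Ay; apply: absolutely_null_eq_mod.
  by move=> mu hmu; rewrite !(banach_ltranslate hmu).
exact: subset_mod_trans xA Ay.
Qed.

Theorem theorem6p1 (R : realType) (X : groupType) (hX : amenable R X) :
  twinic X /\
  is_ideal (absolutely_null R X) /\
  twinic_ideal X `<=` absolutely_null R X.
Proof.
have tN := absolutely_null_twinic R X hX.
split; first by exists (absolutely_null R X).
split; first exact: twinic_is_ideal.
(* An element of the intersection lies in every twinic ideal, in particular in the one supplied by
   [tN]. *)
by move=> A; apply.
Qed.
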